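(* Let $h\in G$ satisfy $h.f(z_0)=f(z_1)$. For every Cartan involution $\theta_0$ of $\mathfrak{g}^{\mathbb{C}}$ commuting with $\tau$ and $\sigma_0$, the three involutions (a) $\tau$, (b) $\sigma_1=\mathrm{Ad}(h)\,\sigma_0\,\mathrm{Ad}(h)^{-1}$, (c) $\theta_1=\mathrm{Ad}(h)\,\theta_0\,\mathrm{Ad}(h)^{-1}$ commute pairwise, and for the construction of compact duals of the inner symmetric space $G/K_1$ relative to $z_1$ it suffices to consider such triples. The correspondence $\theta_0\mapsto\theta_1=\mathrm{Ad}(h)\theta_0\mathrm{Ad}(h)^{-1}$ yields a one-to-one relation between all compact duals relative to $z_0$ and all compact duals relative to $z_1$.
   Context: Setting. $\mathbb{D}$ is a contractible Riemann surface (the unit disk or $\mathbb{C}$). $\mathcal{S}$ is a connected semisimple inner symmetric space, and $G$ is a connected, simply connected real semisimple Lie group acting transitively on $\mathcal{S}$ and containing the isometries of the associated pseudo-Riemannian metric; $G^{\mathbb{C}}$ is its complexification, $\mathfrak{g}=\mathrm{Lie}\,G$. $f:\mathbb{D}\to\mathcal{S}$ is harmonic and $z_0\ne z_1$ are points of $\mathbb{D}$. For $j=0,1$, $K_j$ is the stabilizer of $f(z_j)$ in $G$ (assumed connected), and $\sigma_j$ is the involutive automorphism of $G$ (extended holomorphically to $G^{\mathbb{C}}$ and complex-linearly to $\mathfrak{g}^{\mathbb{C}}$) defining the symmetric space $G/K_j\cong\mathcal{S}$, with $\mathrm{Lie}\,K_j=\{x\in\mathfrak{g}:\sigma_j(x)=x\}$.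 For $h\in G$ with $h.f(z_0)=f(z_1)$ one has $K_1=hK_0h^{-1}$ and $\sigma_1=\mathrm{Ad}(h)\sigma_0\mathrm{Ad}(h)^{-1}$, where $\mathrm{Ad}(h)$ denotes the adjoint action (conjugation by $h$). $\tau$ denotes the anti-holomorphic involution of $\mathfrak{g}^{\mathbb{C}}$ (and of $G^{\mathbb{C}}$) defining the real form $\mathfrak{g}$ (resp. $G$); it is the same for both base points. Compact duals. A compact dual relative to $z_j$ is constructed from three pairwise commuting involutions $\tau,\sigma_j,\theta$, where $\theta$ is an (anti-holomorphic) Cartan involution of $\mathfrak{g}^{\mathbb{C}}$ (extended to $G^{\mathbb{C}}$): with $U$ the maximal compact subgroup of $G^{\mathbb{C}}$ fixed by $\theta$ and $K_j^{\mathbb{C}}$ the connected complex subgroup of $G^{\mathbb{C}}$ with Lie algebra the fixed point algebra of $\sigma_j$ in $\mathfrak{g}^{\mathbb{C}}$, the compact dual of $G/K_j$ determined by $\theta$ is the symmetric space $U/(U\cap K_j^{\mathbb{C}})$ with involution $\sigma_j|_U$. Different choices of $\theta$ may give different compact duals. *)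

(* Defs.v *)
From HB Require Import structures.
From mathcomp Require Import all_boot all_order all_algebra.
From mathcomp Require Import complex.
From mathcomp Require Import all_classical all_reals all_analysis.

Set Implicit Arguments.
Unset Strict Implicit.
Unset Printing Implicit Defensive.

Import Order.TTheory GRing.Theory Num.Theory.
Import numFieldNormedType.Exports.
Local Open Scope classical_set_scope.
Local Open Scope ring_scope.

(* C^k on an open set A, through iterated directional derivatives over the
   scalar field K; for finite-dimensional V and W this is the usual notion when
   K is real, and (for every k) holomorphy when K = R[i]. *)
Fixpoint Ck (K : numFieldType) (V W : normedModType K) (k : nat) (A : set V)
    (f : V -> W) : Prop :=
  (forall x, A x -> {for x, continuous f}) /\
  (if k is k'.+1 then
     forall v : V, (forall x, A x -> derivable f x v) /\ Ck k' A ('D_v f)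
   else True).

Record chart (K : numFieldType) (V : normedModType K) (T : topologicalType) :=
  Chart {
    dom : set T;
    coord : T -> V;
    param : V -> T;
    dom_open : open dom;
    cod_open : open (coord @` dom);
    coordK : forall x, dom x -> param (coord x) = x;
    coord_continuous : forall x, dom x -> {for x, continuous coord};
    param_continuous :
      forall y, (coord @` dom) y -> {for y, continuous param} }.

Definition smooth_on (K : numFieldType) (V W : normedModType K)
    (T T' : topologicalType) (U : set T)
    (A : set (chart V T)) (B : set (chart W T')) (f : T -> T') : Prop :=
  (forall x, U x -> {for x, continuous f}) /\
  (forall c c', A c -> B c' -> forall k,
     Ck k (coord c @` (U `&` dom c `&` f @^-1` dom c'))
          (coord c' \o f \o param c)).

Definition smooth_map (K : numFieldType) (V W : normedModType K)
    (T T' : topologicalType) (A : set (chart V T)) (B : set (chart W T'))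
    (f : T -> T') : Prop := smooth_on setT A B f.

Definition is_manifold (K : numFieldType) (V : normedModType K)
    (T : topologicalType) (A : set (chart V T)) : Prop :=
  [/\ hausdorff_space T, @second_countable T,
      forall x, exists2 c, A c & dom c x
    & smooth_map A A id].

Lemma chart_id_cod_open (K : numFieldType) (V : normedModType K) :
  open ((fun x : V => x) @` setT).
Proof. by rewrite image_id; exact: openT. Qed.

Definition chart_id (K : numFieldType) (V : normedModType K) : chart V V :=
  @Chart K V V setT (fun x => x) (fun x => x) openT (@chart_id_cod_open K V)
    (fun _ _ => erefl) (fun _ _ => cvg_id) (fun _ _ => cvg_id).

Definition vect_atlas (K : numFieldType) (V : normedModType K) :
  set (chart V V) := [set @chart_id K V].

Lemma open_prod (T T' : topologicalType) (A : set T) (B : set T') :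
  open A -> open B -> open (A `*` B).
Proof.
move=> oA oB; rewrite openE => -[x y] [/= Ax By].
by exists (A, B) => //=; split; exact: open_nbhs_nbhs.
Qed.

Section ProductChart.
Variables (K : numFieldType) (V W : normedModType K) (T T' : topologicalType).
Variables (c : chart V T) (c' : chart W T').

Let D : set (T * T') := dom c `*` dom c'.
Let F (p : T * T') : V * W := (coord c p.1, coord c' p.2).
Let P (q : V * W) : T * T' := (param c q.1, param c' q.2).

Let cod_prod : F @` D = (coord c @` dom c) `*` (coord c' @` dom c').
Proof.
apply/seteqP; split=> [_ [[x y] [/= Dx Dy] <-]|[u v] [[x Dx xu] [y Dy yv]]].
  by split; [exists x|exists y].
by exists (x, y) => //; rewrite /F /= xu yv.
Qed.

Let D_open : open D.
Proof. by apply: open_prod; exact: dom_open. Qed.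

Let cod_prod_open : open (F @` D).
Proof. by rewrite cod_prod; apply: open_prod; exact: cod_open. Qed.

Let F_cancel x : D x -> P (F x) = x.
Proof. by case: x => x y [/= Dx Dy]; rewrite /P /F /= !coordK. Qed.

Let F_continuous x : D x -> {for x, continuous F}.
Proof.
case: x => x y [/= Dx Dy].
apply: cvg_pair => /=.
- by apply: (cvg_comp fst (coord c)); [exact: cvg_fst|exact: coord_continuous].
- by apply: (cvg_comp snd (coord c')); [exact: cvg_snd|exact: coord_continuous].
Qed.

Let P_continuous y : (F @` D) y -> {for y, continuous P}.
Proof.
rewrite cod_prod; case: y => x y [/= Dx Dy].
apply: cvg_pair => /=.
- by apply: (cvg_comp fst (param c)); [exact: cvg_fst|exact: param_continuous].
- by apply: (cvg_comp snd (param c')); [exact: cvg_snd|exact: param_continuous].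
Qed.

Definition chart_prod : chart (V * W)%type (T * T')%type :=
  Chart D_open cod_prod_open F_cancel F_continuous P_continuous.

End ProductChart.

Definition prod_atlas (K : numFieldType) (V W : normedModType K)
    (T T' : topologicalType) (A : set (chart V T)) (B : set (chart W T')) :
    set (chart (V * W)%type (T * T')%type) :=
  [set c | exists a b, [/\ A a, B b & c = chart_prod a b]].

Definition simply_connected (R : realType) (T : topologicalType) : Prop :=
  (forall x y : T, exists gam : R -> T,
     [/\ {within `[0, 1], continuous gam}, gam 0 = x & gam 1 = y]) /\
  (forall gam : R -> T, {within `[0, 1], continuous gam} -> gam 0 = gam 1 ->
     exists H : R * R -> T,
       {within `[0, 1] `*` `[0, 1], continuous H} /\
       forall t, t \in `[0, 1] ->
         [/\ H (t, 0) = gam t, H (t, 1) = gam 0,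
             H (0, t) = gam 0 & H (1, t) = gam 0]).

HB.structure Definition TopGroup := {T of Group T & Topological T}.

Notation topGroupType := TopGroup.type.

(* A Lie group of dimension n over K (a complex Lie group when K = R[i]),
   bundled with its Lie algebra, realized on K^n by a choice of basis, its
   exponential map and its adjoint representation. These are no extra
   structure: exp is a local diffeomorphism at 0 and t |-> exp (t x) is a
   one-parameter subgroup, so d exp_0 identifies K^n with the tangent space at 1
   and exp with the usual exponential; Ad and the bracket are then determined
   by lg_AdE and lg_bracketE. *)
Record lie_group (K : numFieldType) (n : nat) := LieGroup {
  lg_points :> topGroupType;
  lg_atlas : set (chart 'rV[K]_n lg_points);
  bracket : 'rV[K]_n -> 'rV[K]_n -> 'rV[K]_n;
  expG : 'rV[K]_n -> lg_points;
  Ad : lg_points -> {linear 'rV[K]_n -> 'rV[K]_n};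
  lg_manifold : is_manifold lg_atlas;
  lg_mul_smooth : smooth_map (prod_atlas lg_atlas lg_atlas) lg_atlas
                    (fun p : lg_points * lg_points => (p.1 * p.2)%g);
  lg_inv_smooth : smooth_map lg_atlas lg_atlas (fun x : lg_points => x^-1%g);
  lg_bracketPl : forall (a : K) x y z,
    bracket (a *: x + y) z = a *: bracket x z + bracket y z;
  lg_bracketxx : forall x, bracket x x = 0;
  lg_jacobi : forall x y z,
    bracket x (bracket y z) + bracket y (bracket z x)
      + bracket z (bracket x y) = 0;
  lg_exp_smooth : smooth_map (@vect_atlas K 'rV[K]_n) lg_atlas expG;
  lg_expD : forall (s t : K) x,
    expG ((s + t) *: x) = (expG (s *: x) * expG (t *: x))%g;
  lg_exp_local_diffeo : exists (log : lg_points -> 'rV[K]_n)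
                               (U : set 'rV[K]_n) (V : set lg_points),
    [/\ open U /\ U 0, open V /\ V 1%g,
        forall x, U x -> V (expG x) /\ log (expG x) = x,
        forall g, V g -> U (log g) /\ expG (log g) = g
      & smooth_on V lg_atlas (@vect_atlas K 'rV[K]_n) log];
  lg_AdE : forall a x, (a * expG x * a^-1)%g = expG (Ad a x);
  lg_bracketE : forall x y,
    is_derive (0 : K^o) (1 : K^o)
      (fun t : K^o => Ad (expG ((t : K) *: x)) y) (bracket x y) }.

Arguments bracket {K n} l _ _.
Arguments expG {K n} l _.
Arguments Ad {K n} l _.
Arguments lg_atlas {K n} l.

Definition killing (K : numFieldType) (n : nat) (G : lie_group K n)
    (x y : 'rV[K]_n) : K :=
  \tr (lin1_mx (fun z : 'rV[K]_n => bracket G x (bracket G y z))).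

(* Semisimplicity in Helgason's sense: the Killing form is nondegenerate. *)
Definition semisimple (K : numFieldType) (n : nat) (G : lie_group K n) : Prop :=
  forall x, (forall y, killing G x y = 0) -> x = 0.

Definition group_hom (G H : groupType) (phi : G -> H) : Prop :=
  {morph phi : x y / (x * y)%g}.

Definition is_subgroup (G : groupType) (H : set G) : Prop :=
  [/\ H 1%g, forall x y, H x -> H y -> H (x * y)%g
    & forall x, H x -> H x^-1%g].

(* The connected Lie subgroup with Lie algebra k is generated by exp k. *)
Definition analytic_subgroup (K : numFieldType) (n : nat) (G : lie_group K n)
    (k : set 'rV[K]_n) : set G :=
  smallest (@is_subgroup G) (expG G @` k).

(* phi is an extension to the group of the map dphi of its Lie algebra. *)
Definition integrates (K L : numFieldType) (n m : nat)
    (G : lie_group K n) (H : lie_group L m)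
    (dphi : 'rV[K]_n -> 'rV[L]_m) (phi : G -> H) : Prop :=
  group_hom phi /\ forall x, phi (expG G x) = expG H (dphi x).

Section Complexification.
Variables (R : realType) (n : nat).

Definition cx (x : 'rV[R]_n) : 'rV[R[i]]_n := map_mx (real_complex R) x.

(* Conjugation of the complexified Lie algebra with respect to the real one. *)
Definition tau (X : 'rV[R[i]]_n) : 'rV[R[i]]_n := map_mx conjc X.

Definition complexify (A : 'rV[R]_n -> 'rV[R]_n) (X : 'rV[R[i]]_n) :
    'rV[R[i]]_n :=
  cx (A (map_mx (@complex.Re R) X)) + 'i%C *: cx (A (map_mx (@complex.Im R) X)).

(* GC is the universal complexification of G, and its Lie algebra is the
   complexification of that of G. The map iota need not be injective. For G
   simply connected semisimple, GC is the simply connected complex Lie group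
   integrating the complexified Lie algebra. *)
Definition is_complexification (G : lie_group R n) (GC : lie_group R[i] n)
    (iota : G -> GC) : Prop :=
  [/\ connected [set: GC],
      integrates cx iota, continuous iota,
      forall x y, bracket GC (cx x) (cx y) = cx (bracket G x y)
    & forall (m : nat) (H : lie_group R[i] m) (phi : G -> H),
        group_hom phi -> continuous phi ->
        exists! Phi : GC -> H,
          [/\ group_hom Phi, smooth_map (lg_atlas GC) (lg_atlas H) Phi
            & forall g, Phi (iota g) = phi g]].

End Complexification.

(* Compatibility of phi with metrics given, in each chart c, by the Gram matrix
   g c y at the point with coordinates y. *)
Definition preserves_metric (R : realType) (m : nat) (T : topologicalType)
    (A : set (chart 'rV[R]_m T))
    (g : chart 'rV[R]_m T -> 'rV[R]_m -> 'M[R]_m) (phi : T -> T) : Prop :=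
  forall c c' y, A c -> A c' -> (coord c @` dom c) y ->
    dom c' (phi (param c y)) ->
    let F := coord c' \o phi \o param c in
    forall u v : 'rV[R]_m,
      u *m g c y *m v^T = 'D_u F y *m g c' (F y) *m ('D_v F y)^T.

Record pseudo_riemannian (R : realType) (m : nat) := PseudoRiemannian {
  pr_points :> topologicalType;
  pr_atlas : set (chart 'rV[R]_m pr_points);
  pr_metric : chart 'rV[R]_m pr_points -> 'rV[R]_m -> 'M[R]_m;
  pr_manifold : is_manifold pr_atlas;
  pr_metric_smooth : forall c, pr_atlas c -> forall k,
    Ck k (coord c @` dom c) (pr_metric c);
  pr_metric_sym : forall c y, pr_atlas c -> (coord c @` dom c) y ->
    (pr_metric c y)^T = pr_metric c y;
  pr_metric_nondeg : forall c y, pr_atlas c -> (coord c @` dom c) y ->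
    pr_metric c y \in unitmx;
  pr_metric_compat : preserves_metric pr_atlas pr_metric id }.

Arguments pr_atlas {R m} p.
Arguments pr_metric {R m} p _ _.

Section Geometry.
Variables (R : realType) (m : nat) (S : pseudo_riemannian R m).

Definition isometry (phi : S -> S) : Prop :=
  [/\ bijective phi, smooth_map (pr_atlas S) (pr_atlas S) phi
    & preserves_metric (pr_atlas S) (pr_metric S) phi].

(* The identity component of the isometry group: it is a Lie group for the
   compact-open topology, so its components are path components. *)
Definition isometry_identity_component (phi : S -> S) : Prop :=
  exists H : R * S -> S,
    [/\ {within `[0, 1] `*` setT, continuous H},
        forall t, t \in `[0, 1] -> isometry (fun x => H (t, x)),
        forall x, H (0, x) = x & forall x, H (1, x) = phi x].

Definition pd (p : nat) (i : 'I_p) (F : 'rV[R]_p -> R^o) (y : 'rV[R]_p) : R :=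
  'D_(delta_mx 0 i) F y.

Definition christoffel (c : chart 'rV[R]_m S) (y : 'rV[R]_m)
    (k i j : 'I_m) : R :=
  let g a b := fun y' => pr_metric S c y' a b : R^o in
  2^-1 * \sum_(l < m) invmx (pr_metric S c y) k l *
    (pd i (g j l) y + pd j (g i l) y - pd l (g i j) y).

(* Harmonicity on an open subset D of R^2 = C: vanishing of the tension field
   for the flat metric. By conformal invariance in dimension two, this depends
   only on the Riemann surface structure of D. *)
Definition harmonic_map (D : set 'rV[R]_2) (f : 'rV[R]_2 -> S) : Prop :=
  smooth_on D (@vect_atlas R 'rV[R]_2) (pr_atlas S) f /\
  forall c z (k : 'I_m), pr_atlas S c -> D z -> dom c (f z) ->
    let u i := fun w => coord c (f w) 0 i : R^o in
    \sum_(a < 2) (pd a (pd a (u k)) z +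
      \sum_(i < m) \sum_(j < m)
        christoffel c (coord c (f z)) k i j * pd a (u i) z * pd a (u j) z) = 0.

End Geometry.

(* The points (x, y) of R^2 stand for x + iy. *)
Definition unit_disk (R : realType) : set 'rV[R]_2 :=
  [set z | z 0 0 ^+ 2 + z 0 1 ^+ 2 < 1].

Section Symmetric.
Variables (R : realType) (n m : nat).
Variables (G : lie_group R n) (S : pseudo_riemannian R m) (act : G -> S -> S).

Definition stabilizer (p : S) : set G := [set g | act g p = p].

(* S is a homogeneous space of G, acting by isometries, and the image of G
   contains the identity component of the isometry group of S. *)
Definition isometric_homogeneous : Prop :=
  [/\ forall x, act 1%g x = x,
      forall g k x, act (g * k)%g x = act g (act k x),
      smooth_map (prod_atlas (lg_atlas G) (pr_atlas S)) (pr_atlas S)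
        (fun q : G * S => act q.1 q.2),
      forall x y, exists g, act g x = y
    & (forall g, isometry (act g)) /\
      forall phi, isometry_identity_component phi ->
        exists g, forall x, act g x = phi x].

(* sigma, with differential dsigma, is the involution defining the symmetric
   space G / stabilizer p; the last clause says that the Lie algebra of the
   stabilizer is the fixed point algebra of dsigma. *)
Definition symmetry_at (p : S) (sigma : G -> G)
    (dsigma : {linear 'rV[R]_n -> 'rV[R]_n}) : Prop :=
  [/\ smooth_map (lg_atlas G) (lg_atlas G) sigma,
      integrates dsigma sigma,
      involutive sigma,
      stabilizer p `<=` [set g | sigma g = g]
    & forall x, (forall t : R, stabilizer p (expG G (t *: x))) <->
                dsigma x = x].

Definition inner_automorphism (sigma : G -> G) : Prop :=
  exists c : G, forall g, sigma g = (c * g * c^-1)%g.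

End Symmetric.

(* A symmetric space A / B, for a subgroup A of an ambient group, with its
   involution of A, recorded by its graph. *)
Record symmetric_space (T : Type) := SymmetricSpace {
  ss_group : set T;
  ss_isotropy : set T;
  ss_involution : set (T * T) }.

Section CompactDual.
Variables (R : realType) (n : nat) (GC : lie_group R[i] n).

Local Notation gC := 'rV[R[i]]_n.

(* On R[i], 0 < z means that z is real and positive. *)
Definition cartan_involution (theta : gC -> gC) : Prop :=
  [/\ forall (a : R[i]) X Y,
        theta (a *: X + Y) = conjc a *: theta X + theta Y,
      forall X Y,
        theta (bracket GC X Y) = bracket GC (theta X) (theta Y),
      involutive theta
    & forall X, X != 0 -> 0 < - killing GC X (theta X)].

Definition commuting (a b : gC -> gC) : Prop := forall X, a (b X) = b (a X).

Definition pairwise_commuting (a b c : gC -> gC) : Prop :=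
  [/\ commuting a b, commuting a c & commuting b c].

(* The Cartan involutions entering the construction of compact duals for the
   involution s of the complexified Lie algebra. *)
Definition admissible (s : gC -> gC) : set (gC -> gC) :=
  [set theta | cartan_involution theta /\
               pairwise_commuting (@tau R n) s theta].

(* P is the compact dual U / (U `&` K) determined by theta, for the involution
   s and its extension sC to the group; U is the fixed point group of the
   extension Theta of theta to GC, which exists and is unique when GC is
   connected and simply connected. *)
Definition compact_dual_of (s : gC -> gC) (sC : GC -> GC) (theta : gC -> gC)
    (P : symmetric_space GC) : Prop :=
  exists Theta : GC -> GC,
    [/\ integrates theta Theta, continuous Theta
      & let U := [set g | Theta g = g] in
        P = SymmetricSpace U
              (U `&` analytic_subgroup (G := GC) [set X | s X = X])
              [set q | U q.1 /\ q.2 = sC q.1]].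

Definition compact_dual (s : gC -> gC) (sC : GC -> GC)
    (P : symmetric_space GC) : Prop :=
  exists2 theta, admissible s theta & compact_dual_of s sC theta P.

(* Ad g o theta o (Ad g)^-1 *)
Definition Ad_conj (g : GC) (theta : gC -> gC) : gC -> gC :=
  fun X => Ad GC g (theta (Ad GC g^-1%g X)).

End CompactDual.

(* Main.v *)
Require Import Defs.
From HB Require Import structures.
From mathcomp Require Import all_boot all_order all_algebra.
From mathcomp Require Import complex.
From mathcomp Require Import all_classical all_reals all_analysis.
Set Implicit Arguments.
Unset Strict Implicit.
Unset Printing Implicit Defensive.
Import Order.TTheory GRing.Theory Num.Theory.
Import numFieldNormedType.Exports.
Local Open Scope classical_set_scope.
Local Open Scope ring_scope.

(** Everything is transported by conjugation with [iota h]: since [h] is real,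
[Ad (iota h)] is the complexification of [Ad h], hence commutes with [tau], and
being an automorphism of the complexified Lie algebra it preserves the Killing
form. Therefore [Ad_conj (iota h)] fixes [tau], preserves commutation, maps
Cartan involutions to Cartan involutions, and has [Ad_conj (iota h)^-1] as its
inverse ([Ad_conj_admissible], [Ad_conjK]).

That it carries the involution at [f z0] to the one at [f z1] is a property of
the Lie algebra, not part of the data: [sigma0] and [sigma1] are only tied to
the two stabilizers, which are conjugate by [h]. So the differential of
[sigma1] and the [Ad h]-conjugate of that of [sigma0] are two involutive
automorphisms with the same fixed points. In a semisimple Lie algebra this
forces equality, the (-1)-eigenspace being the Killing orthogonal of the fixed
points ([involution_eq_fixed], [symmetry_at_translate]). All the infinitesimal
facts about homomorphisms of Lie groups come from the injectivity of [expG]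
near 0 ([expG_ray_inj]).

For the relation between compact duals, different Cartan involutions may give
the same dual, so one has to see that the relation is still single-valued in
both directions. For a fixed base point, a compact dual is determined by its
compact group [U] alone ([compact_dual_of_eq]). A connected group is generated
by exponentials, so the extension of [theta] to it is unique
([integrates_ext]), and the extension of the conjugate of [theta] is the
conjugate of the extension: the group of the dual associated with
[Ad_conj a theta] is the conjugate by [a] of the group of the dual associated
with [theta], whichever [theta] defines it ([ss_group_Ad_conj]). *)

(** * Group homomorphisms and conjugation *)

Lemma group_hom1 (G H : groupType) (phi : G -> H) : group_hom phi -> phi 1%g = 1%g.
Proof. by move=> hom; apply: (@mulgI H (phi 1%g)); rewrite -hom !mulg1. Qed.

Lemma group_homV (G H : groupType) (phi : G -> H) (g : G) :
  group_hom phi -> phi g^-1%g = (phi g)^-1%g.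
Proof.
move=> hom; apply: (@mulgI H (phi g)).
by rewrite -hom !mulgV (group_hom1 hom).
Qed.

Definition conj_by (G : groupType) (g x : G) : G := (g * x * g^-1)%g.

Lemma conj_by_hom (G : groupType) (g : G) : group_hom (conj_by g).
Proof. by move=> x y; rewrite /conj_by !mulgA mulgVK. Qed.

Lemma conj_byK (G : groupType) (g : G) : cancel (conj_by g) (conj_by g^-1%g).
Proof. by move=> x; rewrite /conj_by invgK !mulgA mulVg mul1g mulgVK. Qed.

Lemma conj_byVK (G : groupType) (g : G) : cancel (conj_by g^-1%g) (conj_by g).
Proof. by move=> x; rewrite -{1}(invgK g) conj_byK. Qed.

(** * The exponential map and the adjoint representation *)

Lemma rV_linear_continuous (K : numFieldType) (n m : nat)
    (f : {linear 'rV[K]_n -> 'rV[K]_m}) : continuous f.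
Proof.
have -> : (f : 'rV[K]_n -> 'rV[K]_m) =
    (fun x => \sum_(j < n) x 0 j *: f (delta_mx 0 j)).
  apply/funext => x; rewrite [in LHS](row_sum_delta x) linear_sum.
  by apply: eq_bigr => j _; rewrite linearZ.
apply: continuous_big => //; first exact: add_continuous.
move=> j _ x; have cj := @matrix_normedtype.coord_continuous K 1 n 0 j x.
exact: (cvgZr_tmp cj).
Qed.

Section LieGroup.
Variables (K : numFieldType) (n : nat) (G : lie_group K n).
Local Notation g := 'rV[K]_n.

(** [expG] is injective near 0, and a small positive multiple of [x] and [y]
lies in that neighbourhood. Only positive [t] are asked for because over
[R[i]] these are the real ones, which is all that is known for points coming
from a real group. *)
Lemma expG_ray_inj (x y : g) :
  (forall t : K, 0 < t -> expG G (t *: x) = expG G (t *: y)) -> x = y.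
Proof.
move=> exy; have [log [U [V [[oU U0] _ logK _ _]]]] := lg_exp_local_diffeo G.
have nearU (z : g) : \forall t \near (0 : K)^'+, U (t *: z).
  have : (t *: z) @[t --> (0 : K)^'+] --> (0 : g).
    apply: cvg_at_right_filter; rewrite -[X in _ --> X](scale0r z).
    by apply: (@cvgZr_tmp K g K (nbhs (0 : K)) _ id 0 z); exact: cvg_id.
  by apply; apply: open_nbhs_nbhs.
have [t [[Ux Uy] t_gt0]] : exists t : K, (U (t *: x) /\ U (t *: y)) /\ 0 < t.
  apply: (@filter_ex _ (0 : K)^'+); near=> t; split; first split.
  - by near: t; exact: nearU.
  - by near: t; exact: nearU.
  - by near: t; exact: nbhs_right_gt.
apply: (scalerI (lt0r_neq0 t_gt0)).
by rewrite -(logK _ Ux).2 -(logK _ Uy).2 exy.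
Unshelve. all: by end_near. Qed.

Lemma lg_mul_continuous : continuous (fun p : G * G => (p.1 * p.2)%g).
Proof. by move=> p; apply: (lg_mul_smooth G).1. Qed.

Lemma mulgl_continuous (a : G) : continuous (fun x : G => (a * x)%g).
Proof.
move=> x.
apply: (@continuous_comp G (G * G)%type G (fun x => (a, x)) (fun p => (p.1 * p.2)%g)).
  by apply: cvg_pair => /=; [exact: cvg_cst|exact: cvg_id].
exact: lg_mul_continuous.
Qed.

Lemma mulgr_continuous (a : G) : continuous (fun x : G => (x * a)%g).
Proof.
move=> x.
apply: (@continuous_comp G (G * G)%type G (fun x => (x, a)) (fun p => (p.1 * p.2)%g)).
  by apply: cvg_pair => /=; [exact: cvg_id|exact: cvg_cst].
exact: lg_mul_continuous.
Qed.

Lemma conj_by_continuous (a : G) : continuous (conj_by a).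
Proof.
move=> x; apply: (@continuous_comp G G G (fun x => (a * x)%g) (fun x => (x * a^-1)%g)).
  exact: mulgl_continuous.
exact: mulgr_continuous.
Qed.

(** A subgroup containing all exponentials contains a neighbourhood of 1, so
it is open and, its cosets being open as well, closed. *)
Lemma connected_exp_generated (H : set G) :
  connected [set: G] -> is_subgroup H -> (forall x, H (expG G x)) ->
  forall a, H a.
Proof.
move=> conG [H1 HM HV] Hexp.
have [log [U [V [_ [oV V1] _ VK _]]]] := lg_exp_local_diffeo G.
have HVsub v : V v -> H v by move=> /VK[_ <-].
have nbhsV a : nbhs a [set b | V (a^-1 * b)%g].
  apply: (@mulgl_continuous a^-1%g); rewrite mulVg; exact: open_nbhs_nbhs.
have oH : open H.
  rewrite openE => a Ha; apply: filterS (nbhsV a) => b /HVsub Hb.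
  by rewrite -(mulKg a^-1%g b) invgK; apply: HM.
have oHC : open (~` H).
  rewrite openE => a Ha; apply: filterS (nbhsV a) => b /HVsub Hab Hb.
  by apply: Ha; have := HM _ _ Hb (HV _ Hab); rewrite invgM invgK mulVKg.
have HT : H = [set: G].
  apply: conG; first by exists 1%g.
  - by exists H => //; rewrite setTI.
  - by exists H; [rewrite -openC|rewrite setTI].
by move=> a; rewrite HT.
Qed.

(** The differential determines the homomorphism: the points where two
candidates agree form a subgroup containing all exponentials. *)
Lemma integrates_ext (L : numFieldType) (m : nat) (H : lie_group L m)
    (d : g -> 'rV[L]_m) (phi psi : G -> H) :
  connected [set: G] -> integrates d phi -> integrates d psi -> phi =1 psi.
Proof.
move=> conG [homf expf] [homp expp].
apply: (connected_exp_generated (H := [set a | phi a = psi a])) => //=.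
- split=> /=; first by rewrite !group_hom1.
  + by move=> x y hx hy; rewrite homf homp hx hy.
  + by move=> x hx; rewrite !group_homV // hx.
- by move=> x; rewrite expf expp.
Qed.

Lemma AdM (a b : G) (x : g) : Ad G (a * b)%g x = Ad G a (Ad G b x).
Proof.
by apply: expG_ray_inj => t _; rewrite -!linearZ -!lg_AdE invgM !mulgA.
Qed.

Lemma Ad1 (x : g) : Ad G 1%g x = x.
Proof.
by apply: expG_ray_inj => t _; rewrite -!linearZ -!lg_AdE invg1 mulg1 mul1g.
Qed.

Lemma AdK (a : G) : cancel (Ad G a) (Ad G a^-1%g).
Proof. by move=> x; rewrite -AdM mulVg Ad1. Qed.

Lemma AdVK (a : G) : cancel (Ad G a^-1%g) (Ad G a).
Proof. by move=> x; rewrite -AdM mulgV Ad1. Qed.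

Lemma Ad_integrates (a : G) : integrates (Ad G a) (conj_by a).
Proof. by split=> [|x]; [exact: conj_by_hom|rewrite /conj_by lg_AdE]. Qed.

Lemma integrates_Ad (d : {linear g -> g}) (phi : G -> G) (a : G) (y : g) :
  integrates d phi -> d (Ad G a y) = Ad G (phi a) (d y).
Proof.
move=> [hom expf]; apply: expG_ray_inj => t _.
by rewrite -!linearZ -expf -!lg_AdE !hom group_homV // expf.
Qed.

(** The bracket is the derivative at 0 of [t |-> Ad (expG (t *: x)) y], and [d]
intertwines the adjoint representations by [integrates_Ad]; being continuous,
[d] commutes with the derivative. *)
Lemma integrates_bracket (d : {linear g -> g}) (phi : G -> G) :
  integrates d phi -> {morph d : x y / bracket G x y}.
Proof.
move=> dphi x y.
have [dF FE] := lg_bracketE G x y; have [_ <-] := lg_bracketE G (d x) (d y).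
apply/esym/cvg_lim; first exact: norm_hausdorff.
pose F (t : K^o) := Ad G (expG G ((t : K) *: x)) y.
have dq : d (t^-1 *: ((F \o shift 0) (t *: (1 : K^o)) - F 0))
    @[t --> (0 : K^o)^'] --> d (bracket G x y).
  rewrite -FE; apply: (cvg_comp _ _ dF); exact: rV_linear_continuous.
apply: cvg_trans dq; apply: near_eq_cvg; near=> t.
rewrite linearZ linearB /=.
have [_ expd] := dphi.
by rewrite !(integrates_Ad _ _ dphi) !expd !linearZ.
Unshelve. all: by end_near. Qed.

Lemma integrates_involutive (d : {linear g -> g}) (phi : G -> G) :
  integrates d phi -> involutive phi -> involutive d.
Proof.
move=> [_ expf] phiK x; apply: expG_ray_inj => t _.
by rewrite -!linearZ -!expf phiK.
Qed.

(** Linearity on the right is inherited from that of [Ad] by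
differentiation. *)
Lemma bracket_linearr (x : g) : linear (bracket G x).
Proof.
move=> a y z; pose F w (t : K^o) := Ad G (expG G ((t : K) *: x)) w.
have FP : F (a *: y + z) = (a \*: F y) + F z by apply/funext => t; exact: linearP.
have dF w : is_derive (0 : K^o) (1 : K^o) (F w) (bracket G x w).
  exact: lg_bracketE.
have [_ <-] := dF (a *: y + z); rewrite FP.
by have [_ ->] := is_deriveD (is_deriveZ a (dF y)) (dF z).
Qed.

(** * The Killing form *)

(** [bracket G x] under a name that can carry its structure of linear map, so
that the Killing form becomes the trace of a product of matrices. *)
Definition ad (x y : g) : g := bracket G x y.

HB.instance Definition _ (x : g) :=
  GRing.isLinear.Build K g g _ (ad x) (bracket_linearr x).

Lemma lin1_mx_comp (u v : {linear g -> g}) :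
  lin1_mx (u \o v) = lin1_mx v *m lin1_mx u.
Proof.
apply/row_matrixP => i.
by rewrite row_mul !rowE !mul_rV_lin1.
Qed.

(** An automorphism [d] conjugates [ad x] into [ad (d x)], and the trace is
invariant under conjugation. *)
Lemma killing_morph (d e : {linear g -> g}) : cancel d e -> cancel e d ->
  {morph d : x y / bracket G x y} ->
  forall x y, killing G (d x) (d y) = killing G x y.
Proof.
move=> dK eK dM x y; rewrite /killing.
have -> : (fun z => bracket G (d x) (bracket G (d y) z)) =
    (d \o (ad x \o ad y)) \o e.
  by apply/funext => z /=; rewrite /ad !dM eK.
rewrite (lin1_mx_comp (d \o (ad x \o ad y)) e) (lin1_mx_comp d (ad x \o ad y)).
rewrite mulmxA mxtrace_mulC mulmxA -lin1_mx_comp.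
have -> : lin1_mx (e \o d) = 1%:M.
  by apply/row_matrixP => i; rewrite !rowE mul_rV_lin1 /= dK mulmx1.
by rewrite mul1mx.
Qed.

Lemma killingC (x y : g) : killing G x y = killing G y x.
Proof.
rewrite /killing -[LHS]/(\tr (lin1_mx (ad x \o ad y))).
rewrite -[RHS]/(\tr (lin1_mx (ad y \o ad x))).
rewrite (lin1_mx_comp (ad x) (ad y)) (lin1_mx_comp (ad y) (ad x)).
exact: mxtrace_mulC.
Qed.

Lemma killingDl (x y z : g) : killing G (x + y) z = killing G x z + killing G y z.
Proof.
rewrite /killing -raddfD; congr (\tr _); apply/matrixP => i j.
by rewrite !mxE -[x](scale1r x) lg_bracketPl !scale1r mxE.
Qed.

Lemma killingDr (x y z : g) : killing G x (y + z) = killing G x y + killing G x z.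
Proof. by rewrite killingC killingDl !(killingC x). Qed.

Lemma eq_oppr_eq0 (k : K) : k = - k -> k = 0.
Proof. by move/eqP; rewrite -addr_eq0 -mulr2n mulrn_eq0 /= => /eqP. Qed.

Lemma killing0l (y : g) : killing G 0 y = 0.
Proof. by have /eqP := killingDl 0 0 y; rewrite addr0 -subr_eq subrr => /eqP. Qed.

Lemma killingNl (x y : g) : killing G (- x) y = - killing G x y.
Proof. by apply/eqP; rewrite -addr_eq0 -killingDl addNr killing0l. Qed.

(** On [x + s x], which is fixed, both involutions are the identity. It remains
to see that [s'] negates [xm = x - s x]. The vector [w = xm + s' xm] is fixed
by both involutions; it is Killing orthogonal to the fixed vectors because
[xm] is, and to every [v] because [v + s v] is fixed and
[killing w v = killing w (s v)]. Nondegeneracy gives [w = 0]. *)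
Lemma involution_eq_fixed (s s' : {linear g -> g}) :
  semisimple G -> involutive s -> involutive s' ->
  {morph s : x y / bracket G x y} -> {morph s' : x y / bracket G x y} ->
  (forall x, s x = x <-> s' x = x) -> s =1 s'.
Proof.
move=> ssG sK s'K sM s'M fixss' x.
have ks := killing_morph sK sK sM; have ks' := killing_morph s'K s'K s'M.
pose xm := x - s x; pose xp := x + s x.
have sxm : s xm = - xm by rewrite linearB sK opprB.
have sxp : s' xp = xp by apply/fixss'; rewrite linearD sK addrC.
have xm_orth v : s v = v -> killing G xm v = 0.
  by move=> sv; apply: eq_oppr_eq0; rewrite -[LHS]ks sxm sv killingNl.
have s'xm : s' xm = - xm.
  apply/eqP; rewrite -addr_eq0 addrC; apply/eqP; set w := xm + s' xm.
  have sw : s w = w by apply/fixss'; rewrite linearD s'K addrC.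
  have w_orth v : s v = v -> killing G w v = 0.
    move=> sv; have /fixss' s'v := sv.
    by rewrite killingDl -{2}s'v ks' xm_orth // addr0.
  apply: ssG => v; apply: eq_oppr_eq0; apply/eqP; rewrite -addr_eq0.
  by rewrite -{2}(ks w v) sw -killingDr w_orth // linearD sK addrC.
have two (z : g) : z + z = 0 -> z = 0.
  by move=> /eqP; rewrite -mulr2n -scaler_nat scaler_eq0 pnatr_eq0 /= => /eqP.
apply/subr0_eq/two.
have : s' (xp + xm) = xp - xm by rewrite linearD sxp s'xm.
have -> : xp + xm = x + x by rewrite /xm addrCA /xp addrK.
have -> : xp - xm = s x + s x by rewrite /xm opprB addrCA /xp [x + _]addrC addrK.
by rewrite linearD => e; rewrite addrACA -opprD e subrr.
Qed.

End LieGroup.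

(** * Complexification *)

Section Complexification.
Variables (R : realType) (n : nat).

Lemma cx_split (X : 'rV[R[i]]_n) :
  X = cx (map_mx (@complex.Re R) X) + 'i%C *: cx (map_mx (@complex.Im R) X).
Proof. by apply/matrixP => i j; rewrite !mxE; exact: complexE. Qed.

Lemma Re_complexify (A : 'rV[R]_n -> 'rV[R]_n) (X : 'rV[R[i]]_n) :
  map_mx (@complex.Re R) (complexify A X) = A (map_mx (@complex.Re R) X).
Proof. by apply/matrixP => i j; rewrite !mxE; simpc. Qed.

Lemma Im_complexify (A : 'rV[R]_n -> 'rV[R]_n) (X : 'rV[R[i]]_n) :
  map_mx (@complex.Im R) (complexify A X) = A (map_mx (@complex.Im R) X).
Proof. by apply/matrixP => i j; rewrite !mxE; simpc. Qed.

Lemma complexify_comp (A B : 'rV[R]_n -> 'rV[R]_n) (X : 'rV[R[i]]_n) :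
  complexify A (complexify B X) = complexify (A \o B) X.
Proof. by rewrite {1}/complexify Re_complexify Im_complexify. Qed.

Lemma tau_complexify (A : {linear 'rV[R]_n -> 'rV[R]_n}) (X : 'rV[R[i]]_n) :
  tau (complexify A X) = complexify A (tau X).
Proof.
rewrite /complexify.
have -> : map_mx (@complex.Re R) (tau X) = map_mx (@complex.Re R) X.
  by apply/matrixP => i j; rewrite !mxE; case: (X i j).
have -> : map_mx (@complex.Im R) (tau X) = - map_mx (@complex.Im R) X.
  by apply/matrixP => i j; rewrite !mxE; case: (X i j).
by rewrite linearN; apply/matrixP => i j; rewrite !mxE; simpc.
Qed.

Variables (G : lie_group R n) (GC : lie_group R[i] n) (iota : G -> GC).
Hypothesis iotaP : integrates (@cx R n) iota.

(** [Ad] is characterized by conjugation of exponentials, which [iota]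
respects; but [iota] only sees real multiples of [x], i.e. [t *: cx x] with
[t] real. *)
Lemma Ad_cx (a : G) (x : 'rV[R]_n) : Ad GC (iota a) (cx x) = cx (Ad G a x).
Proof.
have [hom expi] := iotaP.
apply: (@expG_ray_inj _ _ GC) => t /gtr0_real/RRe_real <-.
have cxZ (y : 'rV[R]_n) (r : R) : r%:C%C *: cx y = cx (r *: y).
  by rewrite /cx map_mxZ.
rewrite -[_ *: Ad _ _ _]linearZ !cxZ -linearZ -lg_AdE -!expi.
by rewrite -group_homV // -!hom lg_AdE.
Qed.

Lemma Ad_complexification (a : G) (X : 'rV[R[i]]_n) :
  Ad GC (iota a) X = complexify (Ad G a) X.
Proof. by rewrite {1}(cx_split X) linearD linearZ !Ad_cx. Qed.

Lemma Ad_conj_complexify (a : G) (A : 'rV[R]_n -> 'rV[R]_n) :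
  Ad_conj (iota a) (complexify A) =
  complexify (fun x => Ad G a (A (Ad G a^-1%g x))).
Proof.
apply/funext => X; rewrite /Ad_conj -(group_homV _ iotaP.1).
by rewrite !Ad_complexification !complexify_comp.
Qed.

Lemma Ad_conj_tau (a : G) : Ad_conj (iota a) (@tau R n) = @tau R n.
Proof.
apply/funext => X; rewrite /Ad_conj -(group_homV _ iotaP.1).
rewrite !Ad_complexification tau_complexify -!Ad_complexification.
by rewrite (group_homV _ iotaP.1) AdVK.
Qed.

End Complexification.

(** * Transport of compact duals by conjugation *)

Section CompactDuals.
Variables (R : realType) (n : nat) (GC : lie_group R[i] n).
Local Notation gC := 'rV[R[i]]_n.
Implicit Types (a : GC) (theta s : gC -> gC) (sC : GC -> GC).

Lemma Ad_conjK a : cancel (@Ad_conj R n GC a) (Ad_conj a^-1%g).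
Proof. by move=> theta; apply/funext => X; rewrite /Ad_conj invgK !AdK. Qed.

Lemma Ad_conjVK a : cancel (@Ad_conj R n GC a^-1%g) (Ad_conj a).
Proof. by move=> theta; rewrite -{1}(invgK a) Ad_conjK. Qed.

Lemma Ad_conj_commuting a (s t : gC -> gC) :
  commuting s t -> commuting (Ad_conj a s) (Ad_conj a t).
Proof. by move=> st X; rewrite /Ad_conj !AdK st. Qed.

Lemma Ad_bracket a : {morph Ad GC a : X Y / bracket GC X Y}.
Proof. exact: (integrates_bracket (Ad_integrates a)). Qed.

Lemma killing_Ad a X Y : killing GC (Ad GC a X) (Ad GC a Y) = killing GC X Y.
Proof. exact: (killing_morph (AdK a) (AdVK a) (Ad_bracket a)). Qed.

(** For positivity, the invariance of the Killing form turns the value of the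
form of [Ad_conj a theta] at [X] into that of [theta] at [Ad a^-1 X]. *)
Lemma Ad_conj_cartan a theta :
  cartan_involution GC theta -> cartan_involution GC (Ad_conj a theta).
Proof.
move=> [antilin bra inv pos]; split.
- by move=> k X Y; rewrite /Ad_conj linearP antilin linearP.
- by move=> X Y; rewrite /Ad_conj Ad_bracket bra Ad_bracket.
- by move=> X; rewrite /Ad_conj AdK inv AdVK.
- move=> X X0; rewrite /Ad_conj -{1}(AdVK a X) killing_Ad; apply: pos.
  by apply: contraNneq X0 => e; rewrite -(AdVK a X) e linear0.
Qed.

Lemma Ad_conj_admissible a s theta :
  Ad_conj a (@tau R n) = @tau R n ->
  admissible GC s theta -> admissible GC (Ad_conj a s) (Ad_conj a theta).
Proof.
move=> fixtau [cth [ts tt st]]; split; first exact: Ad_conj_cartan.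
by rewrite -fixtau; split; exact: Ad_conj_commuting.
Qed.

Lemma Ad_conj_integrates a theta (Theta : GC -> GC) :
  integrates theta Theta ->
  integrates (Ad_conj a theta) (conj_by a \o Theta \o conj_by a^-1%g).
Proof.
move=> [hom expT]; split=> [x y|X] /=; first by rewrite conj_by_hom hom conj_by_hom.
by rewrite /conj_by !lg_AdE expT lg_AdE.
Qed.

(** Conjugating by [a] the extension of [theta] to the group gives an extension
of [Ad_conj a theta], and it is still continuous. *)
Lemma compact_dual_of_Ad_conj a s sC s' sC' theta P :
  compact_dual_of (GC := GC) s sC theta P ->
  exists P', compact_dual_of s' sC' (Ad_conj a theta) P'.
Proof.
move=> [Th [intT contT _]]; eexists.
exists (conj_by a \o Th \o conj_by a^-1%g); split; last reflexivity.
- exact: Ad_conj_integrates.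
- move=> x; apply: continuous_comp; first exact: conj_by_continuous.
  by apply: continuous_comp; [exact: contT|exact: conj_by_continuous].
Qed.

Hypothesis conGC : connected [set: GC].

(** By uniqueness of extensions, any extension of [Ad_conj a theta] is the
conjugate by [a] of that of [theta], so its fixed points are the conjugates. *)
Lemma ss_group_Ad_conj a s sC s' sC' theta P P' :
  compact_dual_of (GC := GC) s sC theta P ->
  compact_dual_of s' sC' (Ad_conj a theta) P' ->
  ss_group P' = conj_by a^-1%g @^-1` ss_group P.
Proof.
move=> [Th [intT _ ->]] [Th' [intT' _ ->]] /=.
have T'E := integrates_ext conGC intT' (Ad_conj_integrates a intT).
apply/seteqP; split=> x /=; rewrite T'E /= => fx.
- by rewrite -{2}fx conj_byK.
- by rewrite fx conj_byVK.
Qed.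

(** The Cartan involution enters a compact dual only through the group [U], so
two Cartan involutions with the same [U] give the same dual. *)
Lemma compact_dual_of_eq s sC theta theta' P P' :
  compact_dual_of (GC := GC) s sC theta P -> compact_dual_of s sC theta' P' ->
  ss_group P = ss_group P' -> P = P'.
Proof.
have form th Q : compact_dual_of (GC := GC) s sC th Q ->
    Q = SymmetricSpace (ss_group Q)
          (ss_group Q `&` analytic_subgroup (G := GC) [set X | s X = X])
          [set q | ss_group Q q.1 /\ q.2 = sC q.1].
  by move=> [T [_ _ ->]].
by move=> /form PE /form P'E e; rewrite PE e -P'E.
Qed.

End CompactDuals.

(** * The involutions at two points of the symmetric space *)

Section Symmetries.
Variables (R : realType) (n m : nat).
Variables (G : lie_group R n) (S : pseudo_riemannian R m) (act : G -> S -> S).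

(** The stabilizers of [p] and [act h p] are conjugate by [h], so both sides are
involutive automorphisms with fixed point set the Lie algebra of the stabilizer
of [act h p]. *)
Lemma symmetry_at_translate (p : S) (h : G) (sigma0 sigma1 : G -> G)
    (d0 d1 : {linear 'rV[R]_n -> 'rV[R]_n}) :
  semisimple G -> isometric_homogeneous act ->
  symmetry_at act p sigma0 d0 -> symmetry_at act (act h p) sigma1 d1 ->
  forall x, d1 x = Ad G h (d0 (Ad G h^-1%g x)).
Proof.
move=> ssG [act1 actM _ _ _] [_ int0 inv0 _ fix0] [_ int1 inv1 _ fix1].
have br0 := integrates_bracket int0; have br1 := integrates_bracket int1.
have brA a := integrates_bracket (Ad_integrates (G := G) a).
have inv0' := integrates_involutive int0 inv0.
have inv1' := integrates_involutive int1 inv1.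
pose d := Ad G h \o (d0 \o Ad G h^-1%g).
apply: (@involution_eq_fixed R n G d1 d) => //.
- by move=> x; rewrite /d /= AdK inv0' AdVK.
- by move=> x y; rewrite /d /= brA br0 brA.
move=> x; rewrite -fix1.
have -> : (d x = x) <-> d0 (Ad G h^-1%g x) = Ad G h^-1%g x.
  by split=> e; [rewrite -{2}e /d /= AdK|rewrite /d /= e AdVK].
rewrite -fix0; split=> fixt t; move: (fixt t); rewrite /stabilizer /=.
- by move=> e; rewrite -linearZ -lg_AdE invgK !actM e -!actM mulVg act1.
- rewrite -linearZ -lg_AdE invgK !actM => e.
  by have := congr1 (act h) e; rewrite -actM mulgV act1.
Qed.

End Symmetries.

(** * Conjugation of compact duals *)

Theorem theorem3p8 (R : realType) (n m : nat)
  (G : lie_group R n) (GC : lie_group R[i] n) (iota : G -> GC)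
  (S : pseudo_riemannian R m) (act : G -> S -> S)
  (D : set 'rV[R]_2) (f : 'rV[R]_2 -> S) (z0 z1 : 'rV[R]_2)
  (sigma0 sigma1 : G -> G)
  (dsigma0 dsigma1 : {linear 'rV[R]_n -> 'rV[R]_n})
  (sigma0C sigma1C : GC -> GC) (h : G) :
  connected [set: G] -> simply_connected R G -> semisimple G ->
  is_complexification iota ->
  connected [set: S] -> isometric_homogeneous act ->
  D = @unit_disk R \/ D = setT ->
  harmonic_map D f ->
  D z0 -> D z1 -> z0 <> z1 ->
  connected (stabilizer act (f z0)) -> connected (stabilizer act (f z1)) ->
  symmetry_at act (f z0) sigma0 dsigma0 ->
  symmetry_at act (f z1) sigma1 dsigma1 ->
  inner_automorphism sigma0 -> inner_automorphism sigma1 ->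
  smooth_map (lg_atlas GC) (lg_atlas GC) sigma0C ->
  integrates (complexify dsigma0) sigma0C ->
  smooth_map (lg_atlas GC) (lg_atlas GC) sigma1C ->
  integrates (complexify dsigma1) sigma1C ->
  act h (f z0) = f z1 ->
  let s0 := complexify dsigma0 in
  let s1 := complexify dsigma1 in
  let conj_h := Ad_conj (iota h) in
  let corresponding P0 P1 :=
    exists2 theta0, admissible GC s0 theta0 &
      compact_dual_of s0 sigma0C theta0 P0 /\
      compact_dual_of s1 sigma1C (conj_h theta0) P1 in
  [/\ s1 = conj_h s0,
      forall theta0,
        cartan_involution GC theta0 ->
        commuting theta0 (@tau R n) -> commuting theta0 s0 ->
        cartan_involution GC (conj_h theta0) /\
        pairwise_commuting (@tau R n) s1 (conj_h theta0),
      forall P1, compact_dual s1 sigma1C P1 ->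
        exists2 theta0, admissible GC s0 theta0 &
          compact_dual_of s1 sigma1C (conj_h theta0) P1,
      set_bij (admissible GC s0) (admissible GC s1) conj_h
    & (forall P0, compact_dual s0 sigma0C P0 ->
         exists! P1, corresponding P0 P1) /\
      (forall P1, compact_dual s1 sigma1C P1 ->
         exists! P0, corresponding P0 P1)].
Proof.
move=> _ _ ssG [conGC iotaP _ _ _] _ homS _ _ _ _ _ _ _ sym0 sym1 _ _ _ _ _ _ hf.
move=> s0 s1 conj_h corresponding.
have iotaV : iota h^-1%g = (iota h)^-1%g := group_homV _ iotaP.1.
rewrite -hf in sym1.
have s1E : s1 = conj_h s0.
  rewrite /conj_h /s0 (Ad_conj_complexify iotaP) /s1.
  congr (complexify _); apply/funext.
  exact: symmetry_at_translate homS sym0 sym1.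
pose conj_hV : ('rV[R[i]]_n -> _) -> _ := Ad_conj (iota h)^-1%g.
have conjK : cancel conj_h conj_hV := @Ad_conjK _ _ _ _.
have conjVK : cancel conj_hV conj_h := @Ad_conjVK _ _ _ _.
have s0E : s0 = conj_hV s1 by rewrite s1E conjK.
have adm01 theta0 : admissible GC s0 theta0 -> admissible GC s1 (conj_h theta0).
  by rewrite s1E; apply: Ad_conj_admissible; exact: Ad_conj_tau.
have adm10 theta1 : admissible GC s1 theta1 -> admissible GC s0 (conj_hV theta1).
  by rewrite s0E; apply: Ad_conj_admissible; rewrite -iotaV; exact: Ad_conj_tau.
split=> //.
- move=> theta0 cth ttau ts.
  have [] // : admissible GC s1 (conj_h theta0).
  apply: adm01; split=> //; split=> // X; rewrite ?ttau ?ts //.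
  exact: tau_complexify.
- move=> P1 [theta1 adm P1E]; exists (conj_hV theta1); first exact: adm10.
  by rewrite conjVK.
- split; first exact: adm01.
  + by move=> x y _ _; exact: (can_inj conjK).
  + by move=> theta1 /adm10 adm; exists (conj_hV theta1).
- split=> [P0 [theta0 adm P0E]|P1 [theta1 adm P1E]].
  + have [P1 P1E] := compact_dual_of_Ad_conj (iota h) s1 sigma1C P0E.
    exists P1; split=> [|P1' [theta0' adm' [P0E' P1E']]]; first by exists theta0.
    apply: (compact_dual_of_eq P1E P1E').
    by rewrite (ss_group_Ad_conj conGC P0E P1E) (ss_group_Ad_conj conGC P0E' P1E').
  + have [P0 P0E] := compact_dual_of_Ad_conj (iota h)^-1%g s0 sigma0C P1E.
    exists P0; split=> [|P0' [theta0' adm' [P0E' P1E']]].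
      exists (conj_hV theta1); first exact: adm10.
      by rewrite conjVK.
    (* [theta0'] is rewritten as the conjugate of [conj_h theta0'] so that both
       [P0] and [P0'] arise from [P1] by conjugation with [(iota h)^-1]. *)
    rewrite -/conj_hV in P0E; rewrite -(conjK theta0') in P0E'.
    apply: (compact_dual_of_eq P0E P0E').
    by rewrite (ss_group_Ad_conj conGC P1E P0E) (ss_group_Ad_conj conGC P1E' P0E').
Qed.
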